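(* Let $\mathcal{A}_{1,1}^{+}$ be the class of axiconvex $C^{1,1}$-surfaces in $\mathbb{R}^{3}$. Then for every $\Sigma \in \mathcal{A}_{1,1}^{+}$, $$\int_{\Sigma} H\, dA \geqslant \sqrt{4\pi A(\Sigma)},$$ and equality holds if and only if $\Sigma$ is a sphere. In particular, for any $A_0>0$, denoting by $\mathbb{S}_{A_0}$ the sphere of area $A_0$, $$\int_{\mathbb{S}_{A_0}} H\, dA = \min_{\substack{\Sigma \in \mathcal{A}_{1,1}^{+} \\ A(\Sigma)=A_0}} \int_{\Sigma} H\, dA = \sqrt{4\pi A_0},$$ and the sphere $\mathbb{S}_{A_0}$ is the unique global minimizer of this problem.
   Context: Axisymmetric surfaces. Let $L>0$ and let $\theta:[0,L]\to\mathbb{R}$ be Lipschitz continuous. Put, for $s\in[0,L]$, $x(s)=\int_0^s\cos\theta(t)\,dt$, $z(s)=\int_0^s\sin\theta(t)\,dt$ and $\gamma(s)=(x(s),z(s))$ (a plane curve parametrized by arc length with $\gamma(0)=(0,0)$). The map $\theta$ is called admissible if: (i) $\theta(0)=0$ and $\theta(L)=\pi$; (ii) $x(0)=x(L)=0$ and $z(L)>z(0)=0$; (iii) $\gamma$ is one-to-one on $(0,L)$ and $x(s)>0$ for every $s\in(0,L)$. An axisymmetric $C^{1,1}$-surface is a surface $\Sigma\subset\mathbb{R}^3$ obtained by rotating the curve $\gamma$ of some admissible $\theta$ (for some $L>0$) about the $z$-axis, i.e. the image of $(s,t)\in[0,L]\times[0,2\pi)\mapsto(x(s)\cos t,\,x(s)\sin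 t,\,z(s))$. The class of these surfaces is denoted $\mathcal{A}_{1,1}$. A surface $\Sigma$ is an axiconvex $C^{1,1}$-surface, written $\Sigma\in\mathcal{A}_{1,1}^{+}$, if $\Sigma\in\mathcal{A}_{1,1}$ and its generating map $\theta$ takes values in $[0,\pi]$. The placement of the rotation axis on the $z$-axis and of $\gamma(0)$ at the origin is a normalization of position; spheres are understood in this position (the sphere of radius $R$ corresponds to $L=\pi R$, $\theta(s)=s/R$). Curvature and area. $A$ is the two-dimensional Hausdorff measure (area), and $dA=2\pi x(s)\,ds$ on $\Sigma$. The orientation is by the outer unit normal, with the sign convention that a sphere of radius $R$ has principal curvatures $1/R$. The principal curvatures exist almost everywhere and are $\kappa_1(s)=\sin\theta(s)/x(s)$ and $\kappa_2(s)=\dot\theta(s)$ for a.e. $s\in[0,L]$; the scalar mean curvature is $H=\frac12(\kappa_1+\kappa_2)$. Thus $$\int_\Sigma H\,dA=\pi\int_0^L\left(\sin\theta(s)+\dot\theta(s)x(s)\right)ds,\qquad A(\Sigma)=2\pi\int_0^L x(s)\,ds.$$ *)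

(* Defs.v *)
From HB Require Import structures.
From mathcomp Require Import all_boot all_order all_algebra.
From mathcomp Require Import all_classical all_reals all_analysis.
Set Implicit Arguments.
Unset Strict Implicit.
Unset Printing Implicit Defensive.
Import Order.TTheory GRing.Theory Num.Theory.
Import numFieldNormedType.Exports.
Local Open Scope classical_set_scope.
Local Open Scope ring_scope.

Definition curve_x (R : realType) (theta : R -> R) (s : R) : R :=
  \int[@lebesgue_measure R]_(t in `[0, s]) cos (theta t).

Definition curve_z (R : realType) (theta : R -> R) (s : R) : R :=
  \int[@lebesgue_measure R]_(t in `[0, s]) sin (theta t).

Definition curve (R : realType) (theta : R -> R) (s : R) : R * R :=
  (curve_x theta s, curve_z theta s).

(* [theta] is a total function, but only its values on [0, L] matter. *)
Record admissible (R : realType) (L : R) (theta : R -> R) : Prop := {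
  admissible_lipschitz : [lipschitz theta x | x in `[0, L]%classic];
  admissible_angle0 : theta 0 = 0;
  admissible_angleL : theta L = pi;
  admissible_x0 : curve_x theta 0 = 0;
  admissible_xL : curve_x theta L = 0;
  admissible_z0 : curve_z theta 0 = 0;
  admissible_zL : 0 < curve_z theta L;
  admissible_inj : {in `]0, L[ &, injective (curve theta)};
  admissible_x_gt0 : {in `]0, L[, forall s, 0 < curve_x theta s}
}.

(* An axisymmetric C^{1,1}-surface, given by the data generating it.  Distinct
   records may have the same underlying subset of R^3 (for instance when the
   angles differ outside [0, L]), so equality of surfaces is to be stated with
   [points]. *)
Record axisymmetric_surface (R : realType) := AxisymmetricSurface {
  curve_length : R;
  angle : R -> R;
  curve_length_gt0 : 0 < curve_length;
  angle_admissible : admissible curve_length angle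
}.

Definition points (R : realType) (S : axisymmetric_surface R) :
    set (R * R * R) :=
  [set (curve_x (angle S) st.1 * cos st.2,
        curve_x (angle S) st.1 * sin st.2,
        curve_z (angle S) st.1)
     | st in `[0, curve_length S]%classic `*` `[0, 2 * pi[%classic].

Definition axiconvex (R : realType) (S : axisymmetric_surface R) : Prop :=
  {in `[0, curve_length S], forall s, 0 <= angle S s <= pi}.

(* [derive1] is a total operator; it is the derivative of the angle at almost
   every point of [0, L], the angle being Lipschitz continuous there. *)
Definition mean_curvature (R : realType) (S : axisymmetric_surface R) (s : R)
    : R :=
  let kappa1 := sin (angle S s) / curve_x (angle S) s in
  let kappa2 := derive1 (angle S) s in
  (kappa1 + kappa2) / 2.

(* Integration with respect to the area measure dA = 2 pi x(s) ds of a function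
   which is invariant by rotation, i.e., which only depends on s. *)
Definition area_integral (R : realType) (S : axisymmetric_surface R)
    (f : R -> R) : R :=
  \int[@lebesgue_measure R]_(s in `[0, curve_length S])
    (f s * (2 * pi * curve_x (angle S) s)).

Definition area (R : realType) (S : axisymmetric_surface R) : R :=
  area_integral S (fun=> 1).

Definition total_mean_curvature (R : realType) (S : axisymmetric_surface R)
    : R :=
  area_integral S (mean_curvature S).

(* The spheres are placed as the surfaces are: the pole is at the origin. *)
Definition sphere (R : realType) (r : R) : set (R * R * R) :=
  [set p | p.1.1 ^+ 2 + p.1.2 ^+ 2 + (p.2 - r) ^+ 2 = r ^+ 2].

Definition is_sphere (R : realType) (S : axisymmetric_surface R) : Prop :=
  exists2 r : R, 0 < r & points S = sphere r.

(* Main.v *)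
Require Import Defs.
From HB Require Import structures.
From mathcomp Require Import all_boot all_order all_algebra.
From mathcomp Require Import all_classical all_reals all_analysis.
From mathcomp Require Import measurable_realfun lra ring.
Import Order.TTheory GRing.Theory Num.Theory.
Import numFieldNormedType.Exports.
Local Open Scope classical_set_scope.
Local Open Scope ring_scope.

(* Integrating theta' x by parts, the total mean curvature is pi times the
   integral of sin theta - theta cos theta, while the area is - 2 pi times the
   integral of s cos theta.  Compare Sigma with the sphere whose generating
   curve has the same length L, of radius r = L / pi: since sin is concave on
   [0, pi], its tangent at theta(s) lies above its graph at s / r, i.e.,
     sin (s / r) <= sin theta + (s / r - theta) cos theta.
   Integrating over [0, L] gives that the total mean curvature is at least
   A / (2 r) + 2 pi r, hence at least sqrt (4 pi A) by the inequality of
   arithmetic and geometric means.  Equality forces theta(s) = s / r because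
   sin is strictly concave.
   The angle being merely Lipschitz continuous, the integration by parts rests
   on the fact that a Lipschitz function is almost everywhere differentiable and
   is the integral of its derivative. *)

(** * Integrals and null sets *)

Section null_set_modification.
Local Open Scope ereal_scope.
Import HBNNSimple.
Context d (T : measurableType d) (R : realType).
Variable mu : {measure set T -> \bar R}.

(** The integral of a nonnegative function is the supremum of the integrals of the simple functions
    below it; cutting such a function off on [N] keeps its integral and puts it below [g]. *)
Lemma ge0_le_integral_off_null_set (N : set T) (f g : T -> \bar R) :
  measurable N -> mu N = 0 -> (forall x, 0 <= f x) -> (forall x, 0 <= g x) ->
  (forall x, ~ N x -> f x <= g x) -> \int[mu]_x f x <= \int[mu]_x g x.
Proof.
move=> mN N0 f0 g0 fg; rewrite !ge0_integralTE//.
apply: ge_ereal_sup => _ [h /= hf <-].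
apply: ereal_sup_ubound; exists (proj_nnsfun h (measurableC mN)) => /=.
  move=> x; rewrite mindicE; have [|] := boolP (x \in ~` N).
    by rewrite mulr1 inE => Nx; exact: le_trans (hf x) (fg _ Nx).
  by rewrite mulr0.
rewrite -!integralT_nnsfun; apply: ae_eq_integral => //.
- exact/measurable_EFinP.
- exact/measurable_EFinP.
exists N; split => // x /= /not_implyP[_]; apply: contra_notP => Nx.
by rewrite /= mindicE mem_set// mulr1.
Qed.

(* Unlike in [ae_eq_integral], the functions need not be measurable. *)
Lemma eq_integral_off_null_set (N D : set T) (f g : T -> \bar R) :
  measurable N -> mu N = 0 -> (forall x, D x -> ~ N x -> f x = g x) ->
  \int[mu]_(x in D) f x = \int[mu]_(x in D) g x.
Proof.
move=> mN N0 fg; rewrite [LHS]integral_mkcond [RHS]integral_mkcond.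
have {}fg x : ~ N x -> (f \_ D) x = (g \_ D) x.
  by move=> Nx; rewrite !patchE; case: ifPn => // /set_mem Dx; exact: fg.
rewrite [LHS]integralE [RHS]integralE.
by congr (_ - _); apply/eqP; rewrite eq_le; apply/andP; split;
  apply: (ge0_le_integral_off_null_set N) => // x Nx;
  rewrite ?funeposE ?funenegE fg.
Qed.

End null_set_modification.

(** * Lipschitz functions as integrals of their derivatives *)

Section lipschitz_density.
Context {R : realType}.
Notation mu := (@lebesgue_measure R).
Implicit Types (f : R -> R) (a b x : R).

(** A copy of [f] that carries the two proofs, so that its cumulative structure can be inferred. *)
Definition cumulative_of f (ndf : {homo f : x y / x <= y})
  (rcf : right_continuous f) : R -> R := f.
HB.instance Definition _ f (ndf : {homo f : x y / x <= y})
    (rcf : right_continuous f) :=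
  isCumulative.Build R _ R (cumulative_of f ndf rcf) ndf rcf.

Lemma lebesgue_stieltjes_measure_itvoc (u : cumulative R R) x y : x <= y ->
  lebesgue_stieltjes_measure u `]x, y]%classic = (u y - u x)%:E.
Proof.
move=> xy; rewrite /lebesgue_stieltjes_measure/= /measure_extension.
rewrite measurable_mu_extE; last exact: is_ocitv.
by rewrite /= wlength_itv_bnd.
Qed.

(* The Stieltjes measures of f and of id - f add up to the Lebesgue measure, which
   therefore dominates the former: p is its Radon-Nikodym derivative. *)
Lemma monotone_contraction_density f a b : a <= b ->
  {homo f : x y / x <= y} -> {homo (fun x => x - f x) : x y / x <= y} ->
  exists p : R -> R, mu.-integrable setT (EFin \o p) /\
    forall x, x \in `[a, b] -> f x - f a = \int[mu]_(t in `[a, x]) p t.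
Proof.
move=> ab ndf ndh; pose h x := x - f x.
(* For x <= y the two monotonicities give 0 <= u y - u x <= y - x. *)
have rc u : {homo u : x y / x <= y} -> {homo (fun x => x - u x) : x y / x <= y} ->
    right_continuous u.
  move=> ndu ndk x; apply/cvgrPdist_le => e e0; near=> y.
  have xy : x <= y by near: y; exact: nbhs_right_ge.
  rewrite distrC ger0_norm ?subr_ge0 ?ndu//.
  have := ndk _ _ xy; have : y <= x + e by near: y; apply: nbhs_right_le; rewrite ltrDl.
  by lra.
have rcf := rc f ndf ndh.
have rch : right_continuous h.
  by apply: rc => // x y xy; rewrite /h !subKr ndf.
pose cf : cumulative R R := cumulative_of f ndf rcf.
pose ch : cumulative R R := cumulative_of h ndh rch.
pose nu := lebesgue_stieltjes_measure cf.
have muE A : measurable A -> mu A = (nu A + lebesgue_stieltjes_measure ch A)%E.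
  move=> mA; rewrite -measure_addE; apply: lebesgue_measure_unique => // X.
  case/ocitvP => [->|[[x y] /= xy ->]]; first by rewrite !measure0.
  have cfE := lebesgue_stieltjes_measure_itvoc cf _ _ (ltW xy).
  have chE := lebesgue_stieltjes_measure_itvoc ch _ _ (ltW xy).
  apply: eq_trans (lebesgue_stieltjes_measure_itvoc _ _ _ (ltW xy)) _.
  apply: eq_trans _ (esym (measure_addE nu (lebesgue_stieltjes_measure ch) _)).
  apply: eq_trans _ (esym (congr2 adde cfE chE)).
  apply: eq_trans _ (EFinD _ _); congr (_%:E); rewrite /=.
  by rewrite /cumulative_of /h; ring.
have numu A : measurable A -> (nu A <= mu A)%E.
  by move=> mA; rewrite muE// leeDl.
(* Restricting [nu] to ]a, b] makes it finite, as Radon-Nikodym requires. *)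
have mab : measurable (`]a, b]%classic : set (measurableTypeR R)).
  exact: measurable_itv.
have nuoo : (nu `]a, b]%classic < +oo)%E.
  by rewrite /nu lebesgue_stieltjes_measure_itvoc// ltry.
have [|q [q0 qfin intq qE]] := @radon_nikodym_sigma_finite _ _ _ mu
    (mfrestr mab nuoo).
  apply/null_content_dominatesP => A mA A0.
  apply/eqP; rewrite eq_le measure_ge0 andbT /mfrestr /mrestr -A0.
  apply: le_trans (numu _ mA); apply: le_measure; rewrite ?inE//.
  exact: measurableI.
exists (fine \o q); split.
  by rewrite (_ : _ \o _ = q)//; apply/funext => x /=; rewrite fineK.
move=> x /[!in_itv]/= /andP[ax xb]; rewrite /Rintegral.
under eq_integral do rewrite fineK//.
(* The restriction removes the endpoint a from [a, x], so what is measured is ]a, x]. *)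
have nuE : mfrestr mab nuoo `[a, x]%classic = (f x - f a)%:E.
  rewrite -(lebesgue_stieltjes_measure_itvoc cf _ _ ax) /mfrestr /mrestr.
  by congr nu; apply/seteqP; split=> y /=; rewrite !in_itv/=; lra.
have /esym := qE `[a, x]%classic (measurable_itv `[a, x]).
by move=> ->; exact: esym (congr1 fine nuE).
Unshelve. all: by end_near. Qed.

(** An affine change turns [F] into a monotone contraction. Its density is carried back to [F], and
    Lebesgue differentiation of the integral gives the derivative almost everywhere. *)
Lemma lipschitz_ae_derivable (k : R) (F : R -> R) a b : 0 < k -> a < b ->
  {in `[a, b] &, forall x y, `|F x - F y| <= k * `|x - y|} ->
  exists g : R -> R, [/\ mu.-integrable setT (EFin \o g),
    F b - F a = \int[mu]_(t in `[a, b]) g t &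
    {ae mu, forall x, x \in `]a, b[ -> derivable F x 1 /\ derive1 F x = g x}].
Proof.
(* Clamping the argument to [a, b] makes the Lipschitz bound hold on the whole line. *)
move=> k0 ab Fk; pose c x := Num.max a (Num.min x b).
have cab x : c x \in `[a, b].
  by rewrite in_itv/= le_max lexx/= ge_max (ltW ab)/= ge_min lexx orbT.
have cid x : x \in `[a, b] -> c x = x.
  rewrite in_itv/= => /andP[ax xb].
  by rewrite /c (min_idPl xb) (max_idPr ax).
have c1 x y : x <= y -> 0 <= c y - c x <= y - x.
  rewrite /c /Num.max /Num.min; do !case: ifPn; lra.
(* The slopes of [F (c x) / k] lie in [-1, 1]; averaging with the identity brings them into
   [0, 1]. *)
pose f x := (x + F (c x) / k) / 2.
have Fc x y : x <= y -> `|F (c y) / k - F (c x) / k| <= y - x.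
  move=> xy; rewrite -mulrBl normrM normfV (gtr0_norm k0) ler_pdivrMr// mulrC.
  apply: le_trans (Fk _ _ (cab y) (cab x)) _; rewrite ler_pM2l//.
  by have /andP[? ?] := c1 _ _ xy; rewrite ger0_norm.
have [||p [intp pE]] := monotone_contraction_density f _ _ (ltW ab).
- by move=> x y xy; have := Fc _ _ xy; rewrite ler_norml /f; lra.
- by move=> x y xy; have := Fc _ _ xy; rewrite ler_norml /f; lra.
(* On [a, b], F = k (2 f - id). The indicator is the derivative of id there, and keeps [g]
   integrable on the whole line. *)
pose g t := k * (2 * p t - \1_`[a, b]%classic t).
have intI : mu.-integrable setT (EFin \o (\1_`[a, b]%classic : R -> R)).
  exact: (integrable_indic_itv a b true false).
have int2p : mu.-integrable setT (EFin \o (fun t => 2 * p t)).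
  exact: (integrableZl measurableT 2 intp).
have int2pI : mu.-integrable setT (EFin \o (fun t => 2 * p t - \1_`[a, b]%classic t)).
  exact: (integrableB measurableT int2p intI).
have intg : mu.-integrable setT (EFin \o g).
  exact: (integrableZl measurableT k int2pI).
have intS (u : R -> R) D : measurable D ->
    mu.-integrable setT (EFin \o u) -> mu.-integrable D (EFin \o u).
  by move=> mD; apply: integrableS.
have FE x : x \in `[a, b] -> F x = F a + \int[mu]_(t in `[a, x]) g t.
  move=> xab; rewrite RintegralZl//; last exact: intS.
  rewrite RintegralB//; [|exact: intS..].
  rewrite RintegralZl//; last exact: intS.
  rewrite (_ : \int[mu]_(t in `[a, x]) \1_`[a, b]%classic t = x - a); last first.
    rewrite (@eq_Rintegral _ _ _ mu _ (cst 1)); last first.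
      move=> t; rewrite inE/= indicE => tax; rewrite mem_set//=.
      by move: tax xab; rewrite !in_itv/=; lra.
    rewrite Rintegral_cst//= mul1r.
    have -> := lebesgue_measure_itv `[a, x].
    move: xab; rewrite in_itv/= lte_fin => /andP[].
    by rewrite le_eqVlt => /predU1P[<-|->//]; rewrite ltxx subrr.
  rewrite -pE// /f !cid//; last by rewrite in_itv/= lexx ltW.
  by field; rewrite gt_eqF.
exists g; split => //.
  by rewrite FE ?in_itv/= ?lexx ?ltW// addrC addKr.
have := @FTC1 R g (BLeft a) (fun y => intS g _ (measurable_itv _) intg)
  (open_integrable_locally openT intg).
apply: filterS; first exact: (ae_filter_ringOfSetsType mu).
move=> x /= gx /[!in_itv]/= /andP[ax xb].
have [] := gx; first by rewrite lte_fin.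
move=> dG G'.
have FG : \near x, F x = F a + \int[mu]_(t in `[a, x]) g t.
  near=> y; apply: FE; apply: subset_itv_oo_cc; near: y.
  by apply: near_in_itvoo; rewrite in_itv/= ax xb.
rewrite /= derive1E in G'.
split.
  apply: near_eq_derivable (derivableD (derivable_cst (F a) _ _) dG).
  by near do apply/esym.
rewrite derive1E (near_eq_derive _ FG) deriveD//.
by rewrite derive_cst add0r.
Unshelve. all: by end_near. Qed.

End lipschitz_density.

(** * Calculus on a closed interval *)

Section calculus_on_segment.
Context {R : realType}.
Notation mu := (@lebesgue_measure R).
Implicit Types (f F u : R -> R) (a b L x : R).

Lemma continuous_segment_integrable u a b : {within `[a, b], continuous u} ->
  mu.-integrable `[a, b] (EFin \o u).
Proof.
by apply: continuous_compact_integrable; exact: segment_compact.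
Qed.

Lemma is_derive_integral u a b x : {within `[a, b], continuous u} ->
  x \in `]a, b[ ->
  is_derive x 1 (fun s => \int[mu]_(t in `[a, s]) u t) (u x).
Proof.
move=> cu xab; have /andP[ax xb] : a < x < b by rewrite in_itv/= in xab.
have cux : {for x, continuous u}.
  by apply: within_continuous_continuous xab => //; exact: lt_trans xb.
have [dx d1] :=
  continuous_FTC1_closed xb (continuous_segment_integrable _ _ _ cu) ax cux.
by rewrite -d1 derive1E; exact: derivableP.
Qed.

Lemma Rintegral_derive f F a b : a < b ->
  {within `[a, b], continuous f} -> {within `[a, b], continuous F} ->
  (forall x, x \in `]a, b[ -> is_derive x 1 F (f x)) ->
  \int[mu]_(t in `[a, b]) f t = F b - F a.
Proof.
move=> ab cf cF dF; rewrite /Rintegral (@continuous_FTC2 R f F a b)//.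
  have /(continuous_within_itvP _ ab)[_ Fa Fb] := cF.
  by split=> // x /dF.
by move=> x /dF dFx; rewrite derive1E derive_val.
Qed.

Lemma is_derive_segment_cst F a b : a < b ->
  {within `[a, b], continuous F} ->
  (forall x, x \in `]a, b[ -> is_derive x 1 F 0) ->
  forall x, x \in `[a, b] -> F x = F a.
Proof.
move=> ab cF dF x /[!in_itv]/= /andP[]; rewrite le_eqVlt => /predU1P[<-//|ax xb].
have sub : `[a, x] `<=` `[a, b] by apply: subset_itvl; rewrite bnd_simp.
have [||c _] := @MVT R F (cst 0) a x ax.
- move=> y /[!in_itv]/= /andP[ay yx]; apply: dF; rewrite in_itv/= ay.
  exact: lt_le_trans yx xb.
- exact: continuous_subspaceW cF.
- by rewrite /= mul0r => /eqP; rewrite subr_eq0 => /eqP.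
Qed.

(** The primitive of [f] from a is squeezed between 0 and the whole integral, so it vanishes, and
    [f] is its derivative. *)
Lemma Rintegral_eq0_continuous f a b : a < b ->
  {within `[a, b], continuous f} -> {in `[a, b], forall x, 0 <= f x} ->
  \int[mu]_(t in `[a, b]) f t = 0 -> {in `]a, b[, forall x, f x = 0}.
Proof.
move=> ab cf f0 I0; pose I s := \int[mu]_(t in `[a, s]) f t.
have intf : mu.-integrable `[a, b] (EFin \o f) by exact: continuous_segment_integrable.
have IE s : s \in `[a, b] -> I s = 0.
  rewrite in_itv/= => /andP[as_ sb]; apply/eqP; rewrite eq_le; apply/andP; split.
    rewrite -I0 -subr_ge0 Rintegral_itvB ?bnd_simp//.
    apply: Rintegral_ge0 => t /=; rewrite in_itv/= => /andP[st tb].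
    by apply: f0; rewrite in_itv/= tb (le_trans as_ (ltW st)).
  apply: Rintegral_ge0 => t /=; rewrite in_itv/= => /andP[at_ ts].
  by apply: f0; rewrite in_itv/= at_ (le_trans ts sb).
move=> x xab; have dI := is_derive_integral _ _ _ _ cf xab.
rewrite -(@derive_val _ _ _ _ _ _ _ dI) -[RHS](derive_cst (0 : R) x (1 : R)).
apply: near_eq_derive; near=> s; apply: IE; apply: subset_itv_oo_cc.
by near: s; exact: near_in_itvoo.
Unshelve. all: by end_near. Qed.

Lemma is_derive_norm_le k F a b : {within `[a, b], continuous F} ->
  (forall x, x \in `]a, b[ -> exists2 d, is_derive x 1 F d & `|d| <= k) ->
  {in `[a, b] &, forall x y, `|F x - F y| <= k * `|x - y|}.
Proof.
move=> cF dF.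
have H x y : x < y -> x \in `[a, b] -> y \in `[a, b] ->
    `|F x - F y| <= k * `|x - y|.
  move=> xy xab yab; have dF' z : z \in `]x, y[ -> z \in `]a, b[.
    by move: xab yab; rewrite !in_itv/=; lra.
  have cFxy : {within `[x, y], continuous F}.
    apply: continuous_subspaceW cF => z /=; move: xab yab; rewrite !in_itv/=; lra.
  have dFxy z : z \in `]x, y[ -> is_derive z 1 F ('D_1 F z).
    by move=> /dF'/dF[d ? _]; exact: derivableP.
  have [c cxy FE] := MVT xy dFxy cFxy.
  rewrite distrC FE normrM (distrC x) ler_wpM2r//.
  by have [d dFc] := dF _ (dF' _ cxy); rewrite derive_val.
move=> x y xab yab; have [xy|yx|->] := ltgtP x y; first exact: H.
  by rewrite distrC (distrC x); exact: H.
by rewrite !subrr normr0 mulr0.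
Qed.

Lemma continuous_integral u a b : a <= b -> {within `[a, b], continuous u} ->
  {within `[a, b], continuous (fun s => \int[mu]_(t in `[a, s]) u t)}.
Proof.
by move=> ab cu; apply: parameterized_integral_continuous => //;
  exact: continuous_segment_integrable.
Qed.

Lemma lipschitz_onP u a b : [lipschitz u x | x in `[a, b]%classic] ->
  exists2 k, 0 < k & {in `[a, b] &, forall x y, `|u x - u y| <= k * `|x - y|}.
Proof.
(* The Lipschitz hypothesis is a bound valid for all constants above some [M] of unknown sign; this
   one is positive and above [M]. *)
move=> [M [_ uM]]; exists (Num.max M 0 + 1); first by rewrite ltr_pwDr// le_max lexx orbT.
move=> x y xab yab; apply: (uM (Num.max M 0 + 1) _ (x, y)) => //.
by rewrite ltr_pwDr// le_max lexx.
Qed.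

Lemma lipschitz_continuous u a b : [lipschitz u x | x in `[a, b]%classic] ->
  {within `[a, b], continuous u}.
Proof.
move=> /lipschitz_onP[k k0 uk]; apply/subspace_continuousP => x xab.
apply/cvgrPdist_le => e e0; near=> y.
apply: le_trans (uk _ _ xab _) _.
  by near: y; exact: withinT.
rewrite mulrC -ler_pdivlMr//; near: y; apply: cvg_within.
by apply: (@cvgr_dist_le _ _ _ (nbhs x) _ id x cvg_id (e / k)); rewrite divr_gt0.
Unshelve. all: by end_near. Qed.

End calculus_on_segment.

(** * Area and total mean curvature as integrals of the angle *)

Section curve_calculus.
Context {R : realType}.
Notation mu := (@lebesgue_measure R).
Variable S : axisymmetric_surface R.
Local Notation L := (curve_length S).
Local Notation theta := (angle S).
Local Notation x := (curve_x theta).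
Local Notation z := (curve_z theta).

Lemma continuous_angle : {within `[0, L], continuous theta}.
Proof. exact: lipschitz_continuous (admissible_lipschitz (angle_admissible S)). Qed.

Lemma continuous_cos_angle : {within `[0, L], continuous (fun s => cos (theta s))}.
Proof.
by move=> s; apply: continuous_comp; [exact: continuous_angle|exact: continuous_cos].
Qed.

Lemma continuous_sin_angle : {within `[0, L], continuous (fun s => sin (theta s))}.
Proof.
by move=> s; apply: continuous_comp; [exact: continuous_angle|exact: continuous_sin].
Qed.

Lemma continuous_curve_x : {within `[0, L], continuous x}.
Proof. exact: continuous_integral (ltW (curve_length_gt0 S)) continuous_cos_angle. Qed.

Lemma continuous_curve_z : {within `[0, L], continuous z}.
Proof. exact: continuous_integral (ltW (curve_length_gt0 S)) continuous_sin_angle. Qed.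

Lemma is_derive_curve_x s : s \in `]0, L[ -> is_derive s 1 x (cos (theta s)).
Proof. exact: is_derive_integral continuous_cos_angle. Qed.

Lemma is_derive_curve_z s : s \in `]0, L[ -> is_derive s 1 z (sin (theta s)).
Proof. exact: is_derive_integral continuous_sin_angle. Qed.

Lemma areaE : area S = 2 * pi * \int[mu]_(s in `[0, L]) x s.
Proof.
rewrite /area /area_integral -RintegralZl//.
  by apply: eq_Rintegral => s _; rewrite mul1r.
exact: continuous_segment_integrable continuous_curve_x.
Qed.

(** Integration by parts with the primitive s x(s), which vanishes at 0 through its factor s and at
    L because x(L) = 0. *)
Lemma integral_curve_x :
  \int[mu]_(s in `[0, L]) x s = - \int[mu]_(s in `[0, L]) (s * cos (theta s)).
Proof.
have cid : {within `[0, L], continuous (@id R)}.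
  by apply: continuous_subspaceT => s; exact: cvg_id.
have cM : {within `[0, L], continuous (fun s => s * cos (theta s))}.
  by move=> s; apply: continuousM; [exact: cid|exact: continuous_cos_angle].
apply/eqP; rewrite -addr_eq0 -RintegralD//; last 2 first.
- exact: continuous_segment_integrable continuous_curve_x.
- exact: continuous_segment_integrable cM.
have cD : {within `[0, L], continuous (fun s => x s + s * cos (theta s))}.
  by move=> s; apply: continuousD; [exact: continuous_curve_x|exact: cM].
have cX : {within `[0, L], continuous (id * x)%R}.
  by move=> s; apply: continuousM; [exact: cid|exact: continuous_curve_x].
have dX s : s \in `]0, L[ -> is_derive s 1 (id * x)%R (x s + s * cos (theta s)).
  move=> /is_derive_curve_x dx; apply: is_derive_eq.
  by rewrite /GRing.scale/= mulr1 addrC.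
rewrite (Rintegral_derive _ _ _ _ (curve_length_gt0 S) cD cX dX).
by rewrite /GRing.mul/= (admissible_xL (angle_admissible S)) mulr0 mul0r subrr.
Qed.

(** As theta and x vanish at 0, they are bounded on [0, L] by k L and L; their Lipschitz constants
    being k and 1, the product has constant 2 k L. *)
Lemma angle_curve_x_lipschitz : exists2 k, 0 < k &
  {in `[0, L] &, forall s t, `|theta s * x s - theta t * x t| <= k * `|s - t|}.
Proof.
have adm := angle_admissible S; have L0 := curve_length_gt0 S.
have [k k0 tk] := lipschitz_onP _ _ _ (admissible_lipschitz adm).
have x1 : {in `[0, L] &, forall s t, `|x s - x t| <= 1 * `|s - t|}.
  apply: is_derive_norm_le continuous_curve_x _ => s /is_derive_curve_x dx.
  by exists (cos (theta s)) => //; exact: cos_max.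
have i0 : 0 \in `[0, L] by rewrite in_itv/= lexx ltW.
have tb s : s \in `[0, L] -> `|theta s| <= k * L.
  move=> sL; have := tk _ _ sL i0; rewrite (admissible_angle0 adm) !subr0.
  move=> /le_trans; apply; rewrite ler_pM2l//.
  by move: sL; rewrite in_itv/= => /andP[? ?]; rewrite ger0_norm.
have xb s : s \in `[0, L] -> `|x s| <= L.
  move=> sL; have := x1 _ _ sL i0; rewrite (admissible_x0 adm) !subr0 mul1r.
  move=> /le_trans; apply.
  by move: sL; rewrite in_itv/= => /andP[? ?]; rewrite ger0_norm.
exists (2 * (k * L)); first by rewrite !mulr_gt0.
move=> s t sL tL.
have -> : theta s * x s - theta t * x t =
    theta s * (x s - x t) + x t * (theta s - theta t) by ring.
apply: le_trans (ler_normD _ _) _; rewrite !normrM.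
have -> : 2 * (k * L) * `|s - t| = k * L * (1 * `|s - t|) + L * (k * `|s - t|) by ring.
by apply: lerD; apply: ler_pM => //; auto.
Qed.

(** In the integrand pi (sin theta + theta' x), theta' x is (theta x)' - theta cos theta, and (theta
    x)' has integral 0 because x vanishes at both ends. *)
Lemma total_mean_curvatureE : total_mean_curvature S =
  pi * \int[mu]_(s in `[0, L]) (sin (theta s) - theta s * cos (theta s)).
Proof.
have adm := angle_admissible S; have L0 := curve_length_gt0 S.
(* theta x is differentiated rather than theta: where it is derivable, so is its
   quotient theta by x. *)
have [k k0 Gk] := angle_curve_x_lipschitz.
have [g [intg gL [N [mN N0 gN]]]] := lipschitz_ae_derivable _ _ _ _ k0 L0 Gk.
have cM : {within `[0, L], continuous (fun s => theta s * cos (theta s))}.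
  by move=> s; apply: continuousM; [exact: continuous_angle|exact: continuous_cos_angle].
have cF : {within `[0, L], continuous (fun s => sin (theta s) - theta s * cos (theta s))}.
  exact: within_continuousB continuous_sin_angle cM.
have intF := continuous_segment_integrable _ _ _ cF.
have intgL : mu.-integrable `[0, L] (EFin \o g) by apply: integrableS intg.
(* At the two ends x vanishes and [kappa1] divides by 0; they are discarded together with [N]. *)
pose P : set (measurableTypeR R) := [set 0] `|` [set L].
have m1 (r : R) : measurable ([set r] : set (measurableTypeR R)).
  exact: (@measurable_set1 R r).
have mP : measurable P by exact: measurableU (m1 0) (m1 L).
have P0 : mu P = 0%E.
  rewrite /P (measureU0 (m1 0) (m1 L)); first exact: lebesgue_measure_set1.
  exact: lebesgue_measure_set1.
transitivity (\int[mu]_(s in `[0, L])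
  (pi * (sin (theta s) - theta s * cos (theta s) + g s))).
  rewrite /total_mean_curvature /area_integral; congr fine.
  apply: (@eq_integral_off_null_set _ _ _ mu (N `|` P)).
  - exact: measurableU.
  - by rewrite measureU0.
  move=> s /= /[!in_itv]/= /andP[s0 sL] /not_orP[Ns /not_orP[/eqP sn0 /eqP snL]].
  have sI : s \in `]0, L[ by rewrite in_itv/= !lt_neqAle s0 sL snL eq_sym sn0.
  have xs : 0 < x s := admissible_x_gt0 adm sI.
  have [dG G'] : derivable (fun s => theta s * x s) s 1 /\
      derive1 (fun s => theta s * x s) s = g s.
    by apply: contrapT => H; apply: Ns; apply: gN => /= /(_ sI).
  rewrite derive1E in G'.
  have dx := is_derive_curve_x s sI.
  have dt : derive1 theta s = (g s - theta s * cos (theta s)) / x s.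
    rewrite derive1E.
    have -> : 'D_1 theta s = 'D_1 ((fun s => theta s * x s) * (fun y => (x y)^-1)) s.
      apply: near_eq_derive; near=> y.
      have xy : 0 < x y.
        by apply: (admissible_x_gt0 adm); near: y; exact: near_in_itvoo.
      by rewrite /GRing.mul/= mulfK ?gt_eqF.
    have xn : x s != 0 by rewrite gt_eqF.
    have dxs : derivable x s 1 by [].
    have dV : derivable (fun y => (x y)^-1) s 1 by exact: derivableV xn dxs.
    rewrite (deriveM dG dV) G' (deriveV xn dxs).
    rewrite (@derive_val _ _ _ _ _ _ _ dx) /GRing.scale/=.
    by field.
  rewrite /mean_curvature dt; congr (_%:E).
  by field; rewrite gt_eqF.
have mL : measurable (`[0, L]%classic : set (measurableTypeR R)).
  exact: measurable_itv.
have intFg : mu.-integrable `[0, L]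
    (EFin \o (fun s => sin (theta s) - theta s * cos (theta s) + g s)).
  exact: (integrableD mL intF intgL).
rewrite RintegralZl//.
rewrite RintegralD// -gL (admissible_xL adm) (admissible_x0 adm).
by rewrite !mulr0 subrr addr0.
Unshelve. all: by end_near. Qed.

End curve_calculus.

(** * The inequality and its equality case *)

Section mean_curvature_inequality.
Context {R : realType}.
Notation mu := (@lebesgue_measure R).

(** By the mean value theorem sin a - sin t = (a - t) cos c with c strictly between a and t, and cos
    is strictly decreasing on [0, pi]. *)
Lemma sin_lt_tangent (t a : R) : t \in `[0, pi] -> a \in `[0, pi] -> a != t ->
  sin a < sin t + (a - t) * cos t.
Proof.
move=> tpi api.
have csin (u v : R) : {within `[u, v], continuous (@sin R)}.
  by apply: continuous_subspaceT => s; exact: continuous_sin.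
have dsin (u v s : R) : s \in `]u, v[ -> is_derive s 1 (@sin R) (cos s).
  by move=> _; exact: is_derive_sin.
rewrite neq_lt => /orP[at_|ta].
  have [c cI sE] := MVT at_ (dsin _ _) (csin _ _).
  have cc : c \in `[0, pi] by move: tpi api cI; rewrite !in_itv/=; lra.
  have := ltr_cos cc tpi; move: cI; rewrite in_itv/= => /andP[ac ct].
  by rewrite ct => ?; nra.
have [c cI sE] := MVT ta (dsin _ _) (csin _ _).
have cc : c \in `[0, pi] by move: tpi api cI; rewrite !in_itv/=; lra.
have := ltr_cos tpi cc; move: cI; rewrite in_itv/= => /andP[tc ca].
by rewrite tc => ?; nra.
Qed.

Lemma sin_le_tangent (t a : R) : t \in `[0, pi] -> a \in `[0, pi] ->
  sin a <= sin t + (a - t) * cos t.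
Proof.
move=> tpi api; have [->|/(sin_lt_tangent _ _ tpi api)/ltW//] := eqVneq a t.
by rewrite subrr mul0r addr0.
Qed.

Lemma is_derive_div (r s : R) : is_derive s 1 ( *%R^~ r^-1) r^-1.
Proof.
have -> : *%R^~ r^-1 = (r^-1 *: id) :> (R -> R).
  by apply/funext => u; rewrite /GRing.scale/= mulrC.
by apply: is_derive_eq; rewrite /GRing.scale/= mulr1.
Qed.

Lemma is_derive_sin_div (r s : R) :
  is_derive s 1 (fun s => sin (s / r)) (cos (s / r) / r).
Proof. exact: is_derive1_comp (is_derive_sin _) (is_derive_div r s). Qed.

Lemma is_derive_cos_div (r s : R) :
  is_derive s 1 (fun s => cos (s / r)) (- sin (s / r) / r).
Proof. exact: is_derive1_comp (is_derive_cos _) (is_derive_div r s). Qed.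

Lemma continuous_sin_div (r a b : R) :
  {within `[a, b], continuous (fun s : R => sin (s / r))}.
Proof.
apply: continuous_subspaceT => s; apply/differentiable_continuous/derivable1_diffP.
by have [] := is_derive_sin_div r s.
Qed.

Lemma continuous_cos_div (r a b : R) :
  {within `[a, b], continuous (fun s : R => cos (s / r))}.
Proof.
apply: continuous_subspaceT => s; apply/differentiable_continuous/derivable1_diffP.
by have [] := is_derive_cos_div r s.
Qed.

Lemma integral_sin_div (r s : R) : r != 0 -> 0 <= s ->
  \int[mu]_(t in `[0, s]) sin (t / r) = r * (1 - cos (s / r)).
Proof.
move=> r0; rewrite le_eqVlt => /predU1P[<-|s0].
  by rewrite set_itv1 Rintegral_set1 mul0r cos0 subrr mulr0.
pose F := (- r) *: (fun s : R => cos (s / r)).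
have dF t : t \in `]0, s[ -> is_derive t 1 F (sin (t / r)).
  move=> _; have dc := is_derive_cos_div r t; apply: is_derive_eq.
  by rewrite /GRing.scale/=; field.
have cF : {within `[0, s], continuous F}.
  by move=> t; apply: continuousZl_tmp; exact: continuous_cos_div.
rewrite (Rintegral_derive _ _ _ _ s0 (continuous_sin_div _ _ _) cF dF).
have FE u : F u = - r * cos (u / r) by [].
by rewrite !FE mul0r cos0; ring.
Qed.


Variable S : axisymmetric_surface R.
Local Notation L := (curve_length S).
Local Notation theta := (angle S).
Local Notation r := (L / pi).

(** The gap at s / r between sin and its tangent at theta(s). The expanded form isolates the
    integrands of [total_mean_curvatureE] and [integral_curve_x]. *)
Definition sine_defect (s : R) : R :=
  sin (theta s) - theta s * cos (theta s) + r^-1 * (s * cos (theta s)) - sin (s / r).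

Lemma radius_gt0 : 0 < r.
Proof. by rewrite divr_gt0 ?curve_length_gt0 ?pi_gt0. Qed.

Lemma sine_defectE s :
  sine_defect s = sin (theta s) + (s / r - theta s) * cos (theta s) - sin (s / r).
Proof. by rewrite /sine_defect; ring. Qed.

Lemma div_radius_itv s : s \in `[0, L] -> s / r \in `[0, pi].
Proof.
rewrite !in_itv/= => /andP[s0 sL].
rewrite divr_ge0 ?(ltW radius_gt0)//= ler_pdivrMr ?radius_gt0//.
by rewrite mulrC divfK ?gt_eqF ?pi_gt0.
Qed.

Lemma continuous_angle_terms :
  {within `[0, L], continuous (fun s => sin (theta s) - theta s * cos (theta s))} /\
  {within `[0, L], continuous (fun s => r^-1 * (s * cos (theta s)))}.
Proof.
have cc := continuous_cos_angle S; split.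
  apply: within_continuousB; first exact: continuous_sin_angle.
  by move=> s; apply: continuousM; [exact: continuous_angle|exact: cc].
have cid : {within `[0, L], continuous (@id R)}.
  by apply: continuous_subspaceT => s; exact: cvg_id.
have cM : {within `[0, L], continuous (fun s => s * cos (theta s))}.
  by move=> s; apply: continuousM; [exact: cid|exact: cc].
have cr : {within `[0, L], continuous (cst r^-1 : R -> R)}.
  by move=> s; exact: cst_continuous.
by move=> s; exact: continuousM (cr s) (cM s).
Qed.

Lemma continuous_sine_defect : {within `[0, L], continuous sine_defect}.
Proof.
have [c1 c2] := continuous_angle_terms.
apply: within_continuousB (continuous_sin_div r _ _).
exact: within_continuousD c1 c2.
Qed.

(** The term 2 r is the integral of sin (s / r), namely r (1 - cos pi) as L / r = pi. Being an
    identity, this also serves the equality case and the computation for spheres. *)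
Lemma total_mean_curvature_defect : total_mean_curvature S =
  pi * (\int[mu]_(s in `[0, L]) sine_defect s +
        (\int[mu]_(s in `[0, L]) curve_x theta s) / r + 2 * r).
Proof.
have [c1 c2] := continuous_angle_terms; have L0 := curve_length_gt0 S.
have mL : measurable (`[0, L]%classic : set (measurableTypeR R)).
  exact: measurable_itv.
have i1 := continuous_segment_integrable _ _ _ c1.
have i2 := continuous_segment_integrable _ _ _ c2.
have i3 := continuous_segment_integrable _ _ _ (continuous_sin_div r 0 L).
have i4 : mu.-integrable `[0, L] (EFin \o (fun s => s * cos (theta s))).
  apply: continuous_segment_integrable => s; apply: continuousM.
    by apply: continuous_subspaceT => {}s; exact: cvg_id.
  exact: continuous_cos_angle.
rewrite total_mean_curvatureE integral_curve_x; congr (pi * _).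
rewrite (RintegralB mL (integrableD mL i1 i2) i3) (RintegralD mL i1 i2).
rewrite (RintegralZl _ mL i4).
rewrite integral_sin_div ?gt_eqF ?radius_gt0 ?(ltW L0)//.
have -> : L / r = pi by rewrite invf_div mulrC divfK// gt_eqF.
by rewrite cospi; ring.
Qed.

Lemma integral_curve_x_ge0 : 0 <= \int[mu]_(s in `[0, L]) curve_x theta s.
Proof.
have adm := angle_admissible S.
apply: Rintegral_ge0 => s /=; rewrite in_itv/= => /andP[].
rewrite le_eqVlt => /predU1P[<- _|s0]; first by rewrite (admissible_x0 adm).
rewrite le_eqVlt => /predU1P[->|sL]; first by rewrite (admissible_xL adm).
by apply/ltW/(admissible_x_gt0 adm); rewrite in_itv/= s0.
Qed.

Hypothesis convS : axiconvex S.

Lemma sine_defect_ge0 : {in `[0, L], forall s, 0 <= sine_defect s}.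
Proof.
move=> s sL; rewrite sine_defectE subr_ge0; apply: sin_le_tangent.
  by rewrite in_itv/=; exact: convS.
exact: div_radius_itv.
Qed.

Lemma mean_curvature_inequality :
  Num.sqrt (4 * pi * area S) <= total_mean_curvature S /\
  (total_mean_curvature S = Num.sqrt (4 * pi * area S) ->
   {in `[0, L], forall s, theta s = s / r}).
Proof.
set A := \int[mu]_(s in `[0, L]) curve_x theta s.
have A0 : 0 <= A := integral_curve_x_ge0.
have r0 := radius_gt0; have p0 := pi_gt0 R.
set D := \int[mu]_(s in `[0, L]) sine_defect s.
have D0 : 0 <= D.
  by apply: Rintegral_ge0 => s sL; apply: sine_defect_ge0.
have U0 : 0 <= A / r + 2 * r.
  by apply: addr_ge0; [exact: divr_ge0 A0 (ltW r0)|exact: mulr_ge0 _ (ltW r0)].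
(* Arithmetic and geometric means: the squares of the two sides differ by the square of pi (A / r -
   2 r). *)
have sqrtE : Num.sqrt (4 * pi * area S) <= pi * (A / r + 2 * r).
  rewrite -[leRHS]ger0_norm; last by rewrite mulr_ge0// ltW.
  rewrite -sqrtr_sqr ler_wsqrtr// areaE -/A -subr_ge0.
  suff -> : (pi * (A / r + 2 * r)) ^+ 2 - 4 * pi * (2 * pi * A) =
      (pi * (A / r - 2 * r)) ^+ 2 by exact: sqr_ge0.
  by move: r0; generalize (curve_length S / pi : R) => q q0; field; rewrite gt_eqF.
have tE : total_mean_curvature S = pi * D + pi * (A / r + 2 * r).
  by rewrite total_mean_curvature_defect -/D -/A; ring.
rewrite tE; split; first by rewrite (le_trans sqrtE)// lerDr mulr_ge0// ltW.
(* Equality puts pi D + pi (A / r + 2 r) below its second term, whence D <= 0. *)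
move=> E; have {}D0 : D = 0.
  apply/eqP; rewrite eq_le D0 andbT -(pmulr_rle0 _ p0).
  by rewrite -(lerD2r (pi * (A / r + 2 * r))) E add0r.
have dz := Rintegral_eq0_continuous _ _ _ (curve_length_gt0 S)
  continuous_sine_defect sine_defect_ge0 D0.
have adm := angle_admissible S.
(* The defect is known to vanish inside the interval; at the ends, admissibility prescribes
   theta. *)
move=> s /[dup] sL; rewrite in_itv/= => /andP[].
rewrite le_eqVlt => /predU1P[<- _|s0]; first by rewrite (admissible_angle0 adm) mul0r.
rewrite le_eqVlt => /predU1P[->|sL'].
  by rewrite (admissible_angleL adm) invf_div mulrC divfK// gt_eqF ?curve_length_gt0.
have : sine_defect s = 0 by apply: dz; rewrite in_itv/= s0.
(* If s / r differed from theta(s), the tangent inequality would be strict and the defect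
   positive. *)
rewrite sine_defectE => dzs; apply/esym/eqP; apply/negPn/negP => neq.
have := sin_lt_tangent (theta s) (s / r) _ (div_radius_itv _ sL) neq.
by rewrite in_itv/= convS// => /(_ isT); rewrite -subr_gt0 dzs ltxx.
Qed.

End mean_curvature_inequality.

(** * Spheres as generated surfaces *)

Section round_surfaces.
Context {R : realType}.
Notation mu := (@lebesgue_measure R).
Implicit Types (r s t : R) (S : axisymmetric_surface R).

Lemma integral_cos_div r s : r != 0 -> 0 <= s ->
  \int[mu]_(t in `[0, s]) cos (t / r) = r * sin (s / r).
Proof.
move=> r0; rewrite le_eqVlt => /predU1P[<-|s0].
  by rewrite set_itv1 Rintegral_set1 mul0r sin0 mulr0.
pose F := r *: (fun s : R => sin (s / r)).
have dF t : t \in `]0, s[ -> is_derive t 1 F (cos (t / r)).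
  move=> _; have dc := is_derive_sin_div r t; apply: is_derive_eq.
  by rewrite /GRing.scale/=; field.
have cF : {within `[0, s], continuous F}.
  by move=> t; apply: continuousZl_tmp; exact: continuous_sin_div.
rewrite (Rintegral_derive _ _ _ _ s0 (continuous_cos_div _ _ _) cF dF).
have FE u : F u = r * sin (u / r) by [].
by rewrite !FE mul0r sin0; ring.
Qed.

(** Stated for a bare angle function because [exists_round] uses it before admissibility is
    established. *)
Lemma curve_x_linear (theta : R -> R) r s : r != 0 -> 0 <= s ->
  {in `[0, s], forall t, theta t = t / r} -> curve_x theta s = r * sin (s / r).
Proof.
move=> r0 s0 tE; rewrite -integral_cos_div//; apply: eq_Rintegral => t.
by rewrite inE => /tE ->.
Qed.

Lemma curve_z_linear (theta : R -> R) r s : r != 0 -> 0 <= s ->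
  {in `[0, s], forall t, theta t = t / r} ->
  curve_z theta s = r * (1 - cos (s / r)).
Proof.
move=> r0 s0 tE; rewrite -integral_sin_div//; apply: eq_Rintegral => t.
by rewrite inE => /tE ->.
Qed.

(** The sphere through its generating data, with the angle prescribed on [0, L] only; [round_points]
    and [sphere_round] link it to the set of points. *)
Definition round S r := [/\ 0 < r, curve_length S = pi * r
  & {in `[0, curve_length S], forall s, angle S s = s / r}].

Lemma round_curve S r s : round S r -> s \in `[0, curve_length S] ->
  curve_x (angle S) s = r * sin (s / r) /\
  curve_z (angle S) s = r * (1 - cos (s / r)).
Proof.
move=> [r0 _ tE]; rewrite in_itv/= => /andP[s0 sL].
have tE' : {in `[0, s], forall t, angle S t = t / r}.
  move=> t; rewrite in_itv/= => /andP[t0 ts]; apply: tE.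
  by rewrite in_itv/= t0 (le_trans ts).
by split; [apply: curve_x_linear|apply: curve_z_linear]; rewrite ?gt_eqF.
Qed.

Lemma round_axiconvex S r : round S r -> axiconvex S.
Proof.
move=> [r0 LE tE] s sL; rewrite tE//; move: sL; rewrite in_itv/= LE => /andP[s0 sL].
by rewrite divr_ge0 ?(ltW r0)//= ler_pdivrMr.
Qed.

Lemma round_integral_curve_x S r : round S r ->
  \int[mu]_(s in `[0, curve_length S]) curve_x (angle S) s = 2 * r ^+ 2.
Proof.
move=> rS; have [r0 LE tE] := rS.
transitivity (\int[mu]_(s in `[0, curve_length S]) (r * sin (s / r))).
  by apply: eq_Rintegral => s; rewrite inE => /(round_curve _ _ _ rS)[].
rewrite RintegralZl//; last first.
  exact: continuous_segment_integrable (continuous_sin_div _ _ _).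
rewrite integral_sin_div ?gt_eqF// ?(ltW (curve_length_gt0 S))//.
rewrite LE mulfK ?gt_eqF// cospi; ring.
Qed.

Lemma round_area S r : round S r -> area S = 4 * pi * r ^+ 2.
Proof. by move=> rS; rewrite areaE (round_integral_curve_x _ _ rS); ring. Qed.

(** The defect vanishes on [0, L], which leaves pi (2 r^2 / r + 2 r). *)
Lemma round_total_mean_curvature S r : round S r ->
  total_mean_curvature S = 4 * pi * r.
Proof.
move=> rS; have [r0 LE tE] := rS.
rewrite total_mean_curvature_defect (round_integral_curve_x _ _ rS).
have Lr : curve_length S / pi = r by rewrite LE mulrC mulKf// gt_eqF// pi_gt0.
rewrite (@eq_Rintegral _ _ _ mu _ (cst 0)); last first.
  by move=> s; rewrite inE => sL; rewrite sine_defectE Lr tE// subrr mul0r addr0 subrr.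
rewrite Rintegral_cst// mul0r Lr add0r; move: r0; clear.
by move=> r0; field; rewrite gt_eqF.
Qed.

Lemma round_total_mean_curvature_sqrt S r : round S r ->
  total_mean_curvature S = Num.sqrt (4 * pi * area S).
Proof.
move=> rS; have [r0 _ _] := rS.
rewrite (round_total_mean_curvature _ _ rS) (round_area _ _ rS).
have -> : 4 * pi * (4 * pi * r ^+ 2) = (4 * pi * r) ^+ 2 by ring.
by rewrite sqrtr_sqr ger0_norm// !mulr_ge0 ?pi_ge0 ?ltW.
Qed.

(** For rho > 0 the angle is acos (a / rho) if b >= 0, and 2 pi - acos (a / rho) if b < 0. *)
Lemma polar_coordinates (a b rho : R) : 0 <= rho -> a ^+ 2 + b ^+ 2 = rho ^+ 2 ->
  exists2 t, t \in `[0, 2 * pi[ & a = rho * cos t /\ b = rho * sin t.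
Proof.
rewrite le_eqVlt => /predU1P[<-|rho0] ab.
  exists 0; first by rewrite in_itv/= lexx mulr_gt0// pi_gt0.
  by rewrite !mul0r; split; nra.
pose c := a / rho; pose d := b / rho.
have cd : c ^+ 2 + d ^+ 2 = 1.
  by rewrite /c /d !expr_div_n -mulrDl ab divff// sqrf_eq0 gt_eqF.
have aE : a = rho * c by rewrite /c mulrC divfK// gt_eqF.
have bE : b = rho * d by rewrite /d mulrC divfK// gt_eqF.
have c1 : -1 <= c <= 1 by apply/andP; split; nra.
have sc : sin (acos c) = `|d|.
  by rewrite sin_acos// -sqrtr_sqr; congr Num.sqrt; rewrite -cd addrC addKr.
have cK : cos (acos c) = c by rewrite acosK// in_itv.
have p0 := pi_gt0 R; have := acos_ge0 c1; have := acos_lepi c1.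
have [d0|d0] := leP 0 d => ac0 acpi.
  exists (acos c); first by rewrite in_itv/= acpi/=; lra.
  by rewrite sc cK ger0_norm.
(* Since d < 0 excludes c = 1, acos c is positive and the angle stays strictly below 2 pi. *)
have c11 : -1 <= c < 1 by move: c1 => /andP[-> c1]/=; nra.
exists (pi *+ 2 - acos c).
  by rewrite in_itv/= -mulr_natl; have := acos_gt0 c11; lra.
rewrite addrC cosD2pi sinD2pi cosN sinN sc cK ltr0_norm// opprK.
by [].
Qed.

Lemma round_points S r : round S r -> points S = sphere r.
Proof.
move=> rS; have [r0 LE _] := rS; rewrite /points /sphere; apply/seteqP; split.
  move=> _ [[s t] /= [sL _] <-] /=.
  have [-> ->] := round_curve _ _ _ rS sL.
  have := cos2Dsin2 t; have := cos2Dsin2 (s / r).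
  move: (cos (s / r)) (sin (s / r)) (cos t) (sin t) => c d e f cd ef.
  have -> : (r * d * e) ^+ 2 + (r * d * f) ^+ 2 + (r * (1 - c) - r) ^+ 2 =
    r ^+ 2 * (d ^+ 2 * (e ^+ 2 + f ^+ 2) + c ^+ 2) by ring.
  by rewrite ef mulr1 addrC cd mulr1.
(* Seen from the centre, a point at height h makes the angle acos ((r - h) / r) with the pole at the
   origin, and its distance to the axis is r times the sine of that angle. *)
move=> [[a b] h] /= abh; pose c := (r - h) / r.
have hE : h = r * (1 - c) by rewrite /c; move: r0; clear => r0; field; rewrite gt_eqF.
have abc : a ^+ 2 + b ^+ 2 = r ^+ 2 * (1 - c ^+ 2) by rewrite hE in abh; lra.
have c2 : c ^+ 2 <= 1.
  by rewrite -subr_ge0 -(pmulr_rge0 _ (exprn_gt0 2 r0)) -abc addr_ge0 ?sqr_ge0.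
have c1 : -1 <= c <= 1 by apply/andP; split; nra.
have cK : cos (acos c) = c by rewrite acosK// in_itv.
have s0 : 0 <= sin (acos c) by rewrite sin_ge0_pi// acos_ge0// acos_lepi.
have [||t t2 [aE bE]] := polar_coordinates a b (r * sin (acos c)).
- exact: mulr_ge0 (ltW r0) s0.
- by rewrite exprMn sin2cos2 cK.
have sL : r * acos c \in `[0, curve_length S].
  by rewrite in_itv/= LE (mulrC pi) ler_pM2l// mulr_ge0 ?(ltW r0) ?acos_ge0// acos_lepi.
exists (r * acos c, t) => //=.
have [-> ->] := round_curve _ _ _ rS sL.
have -> : r * acos c / r = acos c by rewrite mulrC mulKf// gt_eqF.
by rewrite -aE -bE cK -hE.
Qed.


(* The curve is drawn on a circle, so its tangent is orthogonal to its radius; this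
   determines (x, z - r) up to a sign, which is constant by continuity, and then
   cos (theta - s / r) is constant. *)
Lemma sphere_round S r : 0 < r -> points S = sphere r -> round S r.
Proof.
move=> r0 SE; have L0 := curve_length_gt0 S; have adm := angle_admissible S.
set L := curve_length S in L0 adm *; set theta := angle S in adm *.
pose x := curve_x theta; pose z := curve_z theta.
have cx : {within `[0, L], continuous x} := continuous_curve_x S.
have cz : {within `[0, L], continuous z} := continuous_curve_z S.
have rn0 : r != 0 by rewrite gt_eqF.
have circle s : s \in `[0, L] -> x s ^+ 2 + (z s - r) ^+ 2 = r ^+ 2.
  move=> sL; have : points S (x s * cos 0, x s * sin 0, z s).
    by exists (s, 0) => //=; split=> //; rewrite in_itv/= lexx mulr_gt0// pi_gt0.
  by rewrite SE /sphere/= cos0 sin0 mulr1 mulr0 expr0n/= addr0.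
have inL s : s \in `]0, L[ -> s \in `[0, L] by exact: subset_itv_oo_cc.
have tangent s : s \in `]0, L[ ->
    x s * cos (theta s) + (z s - r) * sin (theta s) = 0.
  move=> sL; pose Q : R -> R := (x * x + (z - cst r) * (z - cst r))%R.
  have dx : is_derive s 1 x (cos (theta s)) := is_derive_curve_x S s sL.
  have dz : is_derive s 1 z (sin (theta s)) := is_derive_curve_z S s sL.
  have dQ : is_derive s 1 Q (2 * (x s * cos (theta s) + (z s - r) * sin (theta s))).
    apply: is_derive_eq; rewrite /GRing.scale/= /cst.
    have -> : (z - (fun=> r)) s = z s - r by [].
    by ring.
  have : 'D_1 Q s = 'D_1 (cst (r ^+ 2) : R -> R) s.
    apply: near_eq_derive; near=> t; rewrite -(circle t).
      by rewrite /Q !expr2.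
    by apply: inL; near: t; exact: near_in_itvoo.
  by rewrite derive_val derive_cst => /eqP; rewrite mulf_eq0 pnatr_eq0/= => /eqP.
(* The component of (x, z - r) along the unit normal (sin theta, - cos theta); the tangential one
   being 0, its square is r^2. *)
pose sigma s := x s * sin (theta s) - (z s - r) * cos (theta s).
have sigma2 s : s \in `]0, L[ -> sigma s ^+ 2 = r ^+ 2.
  move=> sL; transitivity ((x s ^+ 2 + (z s - r) ^+ 2) *
      (cos (theta s) ^+ 2 + sin (theta s) ^+ 2) -
      (x s * cos (theta s) + (z s - r) * sin (theta s)) ^+ 2).
    by rewrite /sigma; ring.
  by rewrite circle ?inL// cos2Dsin2 tangent// expr0n/= subr0 mulr1.
have x0 : x 0 = 0 := admissible_x0 adm.
have z0 : z 0 = 0 := admissible_z0 adm.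
have t0 : theta 0 = 0 := admissible_angle0 adm.
have sigma0 : sigma 0 = r by rewrite /sigma x0 z0 t0 cos0; ring.
have czr : {within `[0, L], continuous (fun s => z s - r)}.
  by apply: within_continuousB cz _ => s; exact: cst_continuous.
have csigma : {within `[0, L], continuous sigma}.
  apply: within_continuousB => s.
    exact: continuousM (cx s) (continuous_sin_angle S s).
  exact: continuousM (czr s) (continuous_cos_angle S s).
have sub s : s \in `]0, L[ -> `[0, s] `<=` `[0, L].
  by rewrite in_itv/= => /andP[_ sL]; apply: subset_itvl; rewrite bnd_simp ltW.
(* Starting from sigma(0) = r, reaching - r would require a zero of [sigma], where its square is not
   r^2. *)
have sigmaE s : s \in `]0, L[ -> sigma s = r.
  move=> sL; have /eqP := sigma2 s sL; rewrite eqf_sqr => /orP[/eqP//|/eqP sE].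
  have /andP[s0 sL'] : 0 < s < L by rewrite in_itv/= in sL.
  have [||c] := @IVT R sigma 0 s 0 (ltW s0).
  - by apply: continuous_subspaceW csigma; exact: sub.
  - by rewrite sigma0 sE ge_min le_max oppr_le0 (ltW r0) orbT.
  rewrite in_itv/= le_eqVlt => /andP[/predU1P[<- _|c0 cs sc]].
    by rewrite sigma0 => /eqP; rewrite gt_eqF.
  have := sigma2 c; rewrite in_itv/= c0 (le_lt_trans cs)// => /(_ isT).
  by rewrite sc => /esym/eqP; rewrite expr0n/= sqrf_eq0 gt_eqF.
(* Both coordinates are recovered from the tangential component 0 and the normal component r. *)
have xE s : s \in `]0, L[ -> x s = r * sin (theta s).
  move=> sL; transitivity (x s * (cos (theta s) ^+ 2 + sin (theta s) ^+ 2)).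
    by rewrite cos2Dsin2 mulr1.
  transitivity (cos (theta s) * (x s * cos (theta s) + (z s - r) * sin (theta s)) +
      sin (theta s) * sigma s); first by rewrite /sigma; ring.
  by rewrite tangent// sigmaE//; ring.
have zE s : s \in `]0, L[ -> r - z s = r * cos (theta s).
  move=> sL; transitivity ((r - z s) * (cos (theta s) ^+ 2 + sin (theta s) ^+ 2)).
    by rewrite cos2Dsin2 mulr1.
  transitivity (cos (theta s) * sigma s - sin (theta s) *
      (x s * cos (theta s) + (z s - r) * sin (theta s))); first by rewrite /sigma; ring.
  by rewrite tangent// sigmaE//; ring.
(* Inside the interval this is r cos (theta - s / r), written with x and z, which are differentiable
   there whereas theta need not be. *)
pose E : R -> R :=
  ((cst r - z) * (fun s => cos (s / r)) + x * (fun s => sin (s / r)))%R.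
have EE s : E s = (r - z s) * cos (s / r) + x s * sin (s / r) by [].
have cE : {within `[0, L], continuous E}.
  have crz : {within `[0, L], continuous (cst r - z)}.
    by apply: within_continuousB cz => s; exact: cst_continuous.
  apply: within_continuousD => s.
    exact: continuousM (crz s) (continuous_cos_div r 0 L s).
  exact: continuousM (cx s) (continuous_sin_div r 0 L s).
have dE s : s \in `]0, L[ -> is_derive s 1 E 0.
  move=> sL.
  have dx : is_derive s 1 x (cos (theta s)) := is_derive_curve_x S s sL.
  have dz : is_derive s 1 z (sin (theta s)) := is_derive_curve_z S s sL.
  have dc := is_derive_cos_div r s; have ds := is_derive_sin_div r s.
  apply: is_derive_eq; rewrite /GRing.scale/=.
  have -> : (cst r - z) s = r - z s by [].
  by rewrite xE// zE//; field.
have Er s : s \in `[0, L] -> E s = r.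
  move=> sL; rewrite (is_derive_segment_cst _ _ _ L0 cE dE)// EE z0 x0.
  by rewrite !mul0r cos0; ring.
pose u s := theta s - s / r.
have cu : {within `[0, L], continuous u}.
  apply: within_continuousB; first exact: (continuous_angle S).
  by apply: continuous_subspaceT => s; apply: mulrr_continuous.
have cosu s : s \in `]0, L[ -> cos (u s) = 1.
  move=> sL; apply: (mulfI rn0); rewrite mulr1 -[RHS](Er s (inL _ sL)) EE.
  by rewrite xE// zE// /u cosB; ring.
have u0 : u 0 = 0 by rewrite /u t0 mul0r subrr.
(* If |u| reached pi, it would by continuity from u(0) = 0 take the value pi, where cos is -1 and
   not 1. Below pi, injectivity of cos on [0, pi] gives u = 0. *)
have uz s : s \in `]0, L[ -> u s = 0.
  move=> sL; have /andP[s0 sL'] : 0 < s < L by rewrite in_itv/= in sL.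
  have [us|us] := leP pi `|u s|.
    have cnu : {within `[0, s], continuous (fun t => `|u t|)}.
      move=> t; apply: continuous_comp; last exact: norm_continuous.
      by apply: continuous_subspaceW cu t; exact: sub.
    have [|c] := IVT (v := pi) (ltW s0) cnu.
      by rewrite u0 normr0 ge_min le_max us pi_ge0 orbT.
    rewrite in_itv/= le_eqVlt => /andP[/predU1P[<- _|c0 cs uc]].
      by rewrite u0 normr0 => /eqP; rewrite lt_eqF// pi_gt0.
    have := cosu c; rewrite in_itv/= c0 (le_lt_trans cs)// => /(_ isT).
    by rewrite -cos_norm uc cospi; lra.
  have : cos `|u s| = cos 0 by rewrite cos_norm cosu// cos0.
  move/cos_inj; rewrite !in_itv/= normr_ge0 lexx pi_ge0 (ltW us).
  by move=> /(_ isT isT)/normr0_eq0.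
(* Continuity carries the equality to the ends; at s = L it reads pi = L / r, which fixes the
   length. *)
have uL s : s \in `[0, L] -> theta s = s / r.
  move=> sL; apply/eqP; rewrite -subr_eq0 -/(u s) -u0; apply/eqP.
  apply: (is_derive_segment_cst _ _ _ L0 cu) => // t tL.
  apply: (@near_eq_is_derive _ _ _ (cst 0 : R -> R)).
    by near=> y; rewrite uz//; near: y; exact: near_in_itvoo.
split=> //.
have := uL L; rewrite in_itv/= lexx (ltW L0) (admissible_angleL adm) => /(_ isT) ->.
by rewrite divfK.
Unshelve. all: by end_near. Qed.

Lemma exists_round r : 0 < r -> exists S, round S r.
Proof.
move=> r0; have p0 := pi_gt0 R; have rn0 : r != 0 by rewrite gt_eqF.
have L0 : 0 < pi * r :> R by exact: mulr_gt0.
pose theta : R -> R := fun s => s / r.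
have xE s : 0 <= s -> curve_x theta s = r * sin (s / r).
  by move=> s0; exact: curve_x_linear.
have zE s : 0 <= s -> curve_z theta s = r * (1 - cos (s / r)).
  by move=> s0; exact: curve_z_linear.
have Lr : pi * r / r = pi by rewrite mulfK.
have adm : admissible (pi * r) theta.
  split; rewrite ?xE ?zE ?(ltW L0)// ?Lr ?mul0r ?sin0 ?cos0 ?sinpi ?mulr0 ?subrr ?mulr0//.
  - exists r^-1; split; first by rewrite num_real.
    move=> k rk [s t] /= _; rewrite /theta -mulrBl normrM mulrC ler_wpM2r//.
    by rewrite gtr0_norm ?invr_gt0// ltW.
  - by rewrite /theta mul0r.
  - by rewrite cospi opprK mulr_gt0.
  (* The height alone separates the points of the curve, as cos is injective on [0, pi]. *)
  - have dI s : s \in `]0, pi * r[ -> 0 <= s /\ s / r \in `[0, pi].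
      rewrite !in_itv/= => /andP[s0 sL]; split; first exact: ltW.
      by rewrite (divr_ge0 (ltW s0) (ltW r0))/= ler_pdivrMr// ltW.
    move=> s t /dI[s0 sI] /dI[t0 tI] [_]; rewrite !zE// => /(mulfI rn0) E.
    have /(cos_inj sI tI) : cos (s / r) = cos (t / r) by lra.
    by apply: mulIf; rewrite invr_eq0.
  - move=> s; rewrite in_itv/= => /andP[s0 sL]; rewrite xE ?ltW// mulr_gt0//.
    by rewrite sin_gt0_pi// divr_gt0//= ltr_pdivrMr.
by exists (AxisymmetricSurface L0 adm); split.
Qed.

End round_surfaces.

Theorem theorem1p1 (R : realType) :
  (forall S : axisymmetric_surface R, axiconvex S ->
     Num.sqrt (4 * pi * area S) <= total_mean_curvature S /\
     (total_mean_curvature S = Num.sqrt (4 * pi * area S) <-> is_sphere S)) /\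
  (forall A0 : R, 0 < A0 ->
     (exists B : axisymmetric_surface R, is_sphere B /\ area B = A0) /\
     (forall B : axisymmetric_surface R, is_sphere B -> area B = A0 ->
        [/\ axiconvex B,
            total_mean_curvature B = Num.sqrt (4 * pi * A0),
            forall S : axisymmetric_surface R, axiconvex S -> area S = A0 ->
              total_mean_curvature B <= total_mean_curvature S
          & forall S : axisymmetric_surface R, axiconvex S -> area S = A0 ->
              total_mean_curvature S = total_mean_curvature B ->
              points S = points B])).
Proof.
have p0 := pi_gt0 R.
have sphereP (S : axisymmetric_surface R) : is_sphere S <-> exists r, round S r.
  split=> [[r r0 SE]|[r rS]]; first by exists r; exact: sphere_round.
  by exists r; [case: rS|exact: round_points].
have equality (S : axisymmetric_surface R) : axiconvex S ->
    total_mean_curvature S = Num.sqrt (4 * pi * area S) -> exists r, round S r.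
  move=> convS /(mean_curvature_inequality S convS).2 tE.
  exists (curve_length S / pi); split=> //; first exact: radius_gt0.
  by rewrite mulrC divfK// gt_eqF.
have roundE (S : axisymmetric_surface R) : (exists r, round S r) ->
    total_mean_curvature S = Num.sqrt (4 * pi * area S).
  by move=> [r /round_total_mean_curvature_sqrt].
split=> [S convS|A0 A0_gt0].
  split; first exact: (mean_curvature_inequality S convS).1.
  by split=> [/(equality _ convS)/sphereP|/sphereP/roundE].
split.
  (* The positive solution of 4 pi r^2 = A0. *)
  pose r := Num.sqrt (A0 / (4 * pi)).
  have q0 : 0 < A0 / (4 * pi) by rewrite divr_gt0 ?mulr_gt0.
  have [B rB] := exists_round r (etrans (sqrtr_gt0 _) q0).
  exists B; split; first by apply/sphereP; exists r.
  by rewrite (round_area _ _ rB) sqr_sqrtr ?ltW// mulrC divfK// mulf_neq0// gt_eqF.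
move=> B /sphereP[r rB] AB; have tB := roundE B (ex_intro _ r rB).
rewrite AB in tB; split=> //; first exact: round_axiconvex rB.
  move=> S convS AS; rewrite tB -AS.
  exact: (mean_curvature_inequality S convS).1.
move=> S convS AS; rewrite tB -AS => /(equality _ convS)[q rS].
rewrite (round_points _ _ rB) (round_points _ _ rS); congr sphere.
(* Both surfaces are now spheres, and equal areas force equal radii. *)
have [q0 _ _] := rS; have [r0 _ _] := rB.
have : 4 * pi * q ^+ 2 = 4 * pi * r ^+ 2.
  by rewrite -(round_area _ _ rS) -(round_area _ _ rB) AS AB.
move/(mulfI (lt0r_neq0 (mulr_gt0 (ltr0n R 4) p0))) => /eqP.
by rewrite eqrXn2// ?ltW// => /eqP.
Qed.
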